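(* Let $\mathbb{X}=\{X_t\}_{t\in\mathbb{N}}$ be a discrete time stochastic process taking values in $\mathbb{R}^m$, let $\mathbb{M}=\{M_k\}_{k\in\mathbb{N}^q}$ be its class of partially nested models, let the law of $\mathbb{X}$ be given by an element $m_r\in\bigcup_{k\in\mathbb{N}^q}M_k$ of order $r\in\mathbb{N}^q$ with true parameter $\theta_r$, and let $K\ge r$. Let $\{c_n\}$ be a sequence of positive numbers and let $\hat r$ be the EDC estimator $$\hat r=\operatorname{argmin}_{k\le K}\left\{-\log L_{n,k}(\hat\theta_k)+c_n\gamma(k)\right\},\qquad \gamma(k)=\dim(\Theta_k).$$ Suppose that Assumptions A1–A5 (stated in the context) are satisfied. If $$\liminf_{n\to\infty}\frac{c_n}{\log\log n}=\infty\quad\text{and}\quad\lim_{n\to\infty}\frac{c_n}{n}=0,$$ then $\hat r\to r$ almost surely as $n\to\infty$.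
   Context: Order on indices: for $p,k\in\mathbb{N}^q$, $p\ge k$ iff $p_i\ge k_i$ for all $i=1,\dots,q$; $p\not\ge k$ means that $p\geq k$ fails (i.e. $p<k$ or $p,k$ are not comparable). Models: $E\subseteq\mathbb{R}^m$ is the set of possible values of $X_t$, $\nu$ a fixed measure on $E$, and $x_1^n=x_1\cdots x_n$ a realization of $\mathbb{X}$ up to time $n$. For each $k\in\mathbb{N}^q$, $M_k=\{f_k(x_1^n,\theta,n):\theta\in\Theta_k,\ n\ge1\}$ is a family of densities on $E^n$ with respect to the product measure, indexed by $\theta\in\Theta_k$, a subset of a Euclidean space. Each parameter $\theta$ determines one element of $M_k$, namely the sequence (in $n$) of densities. $M_k\subseteq M_p$ (nested) means: $\Theta_k\subseteq\Theta_p$ and for all $\theta\in\Theta_k$, $x_1^\infty\in E^\infty$ there exists $c\in(0,\infty)$ such that $\lim_{n\to\infty} f_k(x_1^n,\theta)/f_p(x_1^n,\theta)=c$. $\mathbb{M}$ is a class of partially nested models if $M_k\subseteq M_p\Leftrightarrow k\le p$. An element $m_r\in\bigcup_k M_k$ has order $r$ if $m_r\in M_r$ and $m_r\in M_k$ implies $M_r\subseteq M_k$. The true parameter $\theta_r\in\Theta_r$ is the one that gives the density of $\mathbb{X}$. When working in $\Theta_k$ with $k\ge r$, $\Theta_k$ is regarded as a subset of $\mathbb{R}^{\gamma(k)}$, $\gamma(k)=\dim(\Theta_k)$, and interior points and derivatives $D^1_\theta,D^2_\theta,D^3_\theta$ (of orders 1, 2, 3) are taken with respect to these $\gamma(k)$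 coordinates. Functions $L_{n,k}$: $\hat\theta_k=\hat\theta_k(x_1^n)\in\Theta_k$ is the maximum likelihood estimator (MLE) of $\theta_r$ supposing the order $k$, and $L_{n,k}:E^n\times\Theta_k\to\mathbb{R}$ (positive, so that logarithms make sense; written $L_{n,k}(\theta)=L_{n,k}(x_1^n,\theta)$) satisfy $L_{n,k}(x_1^n,\hat\theta_k)=\sup_{\theta\in\Theta_k}L_{n,k}(x_1^n,\theta)$ and, for $\theta\in\Theta_k$ and $p\ge k$, $L_{n,p}(x_1^n,\theta)\ge L_{n,k}(x_1^n,\theta)$ and $\lim_{n\to\infty}L_{n,p}(x_1^n,\theta)/L_{n,k}(x_1^n,\theta)<\infty$. Assumptions. A1: for all $k\ge r$, $\theta_r$ is an interior point of $\Theta_k$ and $\hat\theta_k\to\theta_r$ a.s. A2: for all $k\in\mathbb{N}^q$, $n\in\mathbb{N}$, $\log L_{n,k}(x_1^n,\theta)$ and its derivatives $D^1_\theta\log L_{n,k}$, $D^2_\theta\log L_{n,k}$, $D^3_\theta\log L_{n,k}$ are measurable with respect to $x_1^n$ and continuous with respect to $\theta$. A3: for each $k\ge r$ there exist $c<\infty$ and a symmetric positive definite matrix $A_2$ such that for all $\dot\theta=(1-s)\hat\theta_k+s\theta_r$ with $s\in(0,1)$ ($s$ possibly depending on $n$ and on the sample) and all $(i,j,l)\in\{1,\dots,\gamma(k)\}^3$: $\limsup_{n\to\infty}\frac1n\left|\left(D^3_\theta\log L_{n,k}(\dot\theta)\right)_{i,j,l}\right|<c$ a.s. and $\lim_{n\to\infty}-\frac1n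 D^2_\theta\log L_{n,k}(\dot\theta)=A_2$ a.s. A4: if $k\ge r$, $\limsup_{n\to\infty}\left\|\frac{D^1_\theta\log L_{n,k}(\theta_r)}{\sqrt{2n\log\log n}}\right\|<\infty$ a.s. A5: if $k\not\ge r$, $\lim_{n\to\infty}\frac{\log L_{n,r}(\hat\theta_r)-\log L_{n,k}(\hat\theta_k)}{n}>0$ a.s.
   Formalization: The formal theorem additionally assumes γ(r) < γ(k) for every k with r ≤ k ≤ K and k ≠ r; without it the claim fails, e.g. iid N(θ,1), Θ_k=[0,k+1], L_{n,k}=2^k times the likelihood, r=0, θ_r=1/2, K=1, c_n=√n. *)

(* Defs.v *)
From HB Require Import structures.
From mathcomp Require Import all_boot all_order all_algebra.
From mathcomp Require Import all_classical all_reals all_analysis.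

Set Implicit Arguments.
Unset Strict Implicit.
Unset Printing Implicit Defensive.

Import Order.TTheory GRing.Theory Num.Theory.
Import numFieldNormedType.Exports.

Local Open Scope classical_set_scope.
Local Open Scope ring_scope.

(* Setting: MathComp-Analysis, over an arbitrary R : realType.                *)
(* Indices k in N^q are row vectors 'rV[nat]_q.  Observations live in R^m,    *)
(* represented by m.-tuple R, whose library sigma-algebra is the Borel one.   *)
(* Time is numbered from 0: the sample x_1^n is (x 0, ..., x n.-1).           *)

Definition idx_le (q : nat) (k p : 'rV[nat]_q) : bool :=
  [forall i, (k ord0 i <= p ord0 i)%N].

Definition prefix_tuple (V : Type) (x : nat -> V) (n : nat) : n.-tuple V :=
  [tuple x i | i < n].

Definition power_set_tuple (V : Type) (E : set V) (n : nat) :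
    set (n.-tuple V) :=
  [set x | forall i, E (tnth x i)].
Arguments power_set_tuple {V} E n _.

(* The n-th power of nu, by integration over sections, as the binary product  *)
(* measure of the library (it is the product measure when nu is sigma-finite, *)
(* the only case in which "the" product measure makes sense).                 *)
Fixpoint power_measure (R : realType) (d : measure_display)
    (V : measurableType d) (nu : {measure set V -> \bar R}) (n : nat) :
    set (n.-tuple V) -> \bar R :=
  match n with
  | 0 => fun A => \d_([tuple] : 0.-tuple V) A
  | n'.+1 => fun A =>
      (\int[nu]_x power_measure nu [set t : n'.-tuple V | A (cons_tuple x t)])%E
  end.
Arguments power_measure {R d V} nu n _.

Section Derivatives.
Variables (R : realType) (d : nat).
Implicit Types (g : 'rV[R]_d -> R) (u : 'rV[R]_d).

Definition D1 g u : 'rV[R]_d := \row_i 'D_(delta_mx 0 i) g u.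

Definition D2 g u : 'M[R]_d :=
  \matrix_(i, j) 'D_(delta_mx 0 j) (fun v => D1 g v 0 i) u.

Definition D3 g u (i j l : 'I_d) : R :=
  'D_(delta_mx 0 l) (fun v => D2 g v i j) u.

Definition thrice_differentiable g u : Prop :=
  [/\ differentiable g u,
      forall i, differentiable (fun v => D1 g v 0 i) u
    & forall i j, differentiable (fun v => D2 g v i j) u].

Definition sym_pos_def (A : 'M[R]_d) : Prop :=
  A^T = A /\ forall v : 'rV[R]_d, v != 0 -> 0 < (v *m A *m v^T) 0 0.

End Derivatives.

(* All the parameter sets lie in a common type [par], so that the inclusions  *)
(* Theta k `<=` Theta p are literal.  The injective coordinates [coord k]     *)
(* (with inverse [point k]) are the identification of Theta k with a subset   *)
(* of R^(gamma k); [Theta_dim] says that this subset is full-dimensional,     *)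
(* i.e. that gamma k is the dimension of Theta k.                             *)
Record model_class (R : realType) (m q : nat) (E : set (m.-tuple R))
    (nu : {measure set (m.-tuple R) -> \bar R}) := ModelClass {
  par : Type ;
  Theta : 'rV[nat]_q -> set par ;
  gamma : 'rV[nat]_q -> nat ;
  coord : forall k, par -> 'rV[R]_(gamma k) ;
  point : forall k, 'rV[R]_(gamma k) -> par ;
  dens : 'rV[nat]_q -> forall n, n.-tuple (m.-tuple R) -> par -> R ;
  coordK : forall k theta, Theta k theta -> point (coord k theta) = theta ;
  Theta_dim : forall k, (coord k @` Theta k)° !=set0 ;
  dens_meas : forall k theta n, Theta k theta -> (0 < n)%N ->
    measurable_fun (power_set_tuple E n) (fun x => dens k x theta) ;
  dens_ge0 : forall k theta n x, Theta k theta -> (0 < n)%N ->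
    power_set_tuple E n x -> 0 <= dens k x theta ;
  dens_int1 : forall k theta n, Theta k theta -> (0 < n)%N ->
    (\int[power_measure nu n]_(x in power_set_tuple E n)
       (dens k x theta)%:E = 1)%E
}.
Arguments Theta {R m q E nu} M k _ : rename.
Arguments gamma {R m q E nu} M k : rename.
Arguments coord {R m q E nu M} k _ : rename.
Arguments point {R m q E nu M} k _ : rename.
Arguments dens {R m q E nu M} k {n} _ _ : rename.

Section Models.
Variables (R : realType) (m q : nat) (E : set (m.-tuple R)).
Variables (nu : {measure set (m.-tuple R) -> \bar R}).
Variable (M : model_class q E nu).
Implicit Types (k p r : 'rV[nat]_q).

Local Notation V := (m.-tuple R).
Local Notation En := (power_set_tuple E).

Definition coord_set k : set 'rV[R]_(gamma M k) := coord k @` Theta M k.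
Local Arguments coord_set k _ : clear implicits.

Definition nested k p : Prop :=
  Theta M k `<=` Theta M p /\
  forall (theta : par M) (x : nat -> V), Theta M k theta -> (forall t, E (x t)) ->
    exists2 c : R, 0 < c &
      dens k (prefix_tuple x n) theta / dens p (prefix_tuple x n) theta
        @[n --> \oo] --> c.

Definition partially_nested : Prop := forall k p, nested k p <-> idx_le k p.

(* An element of a model is a sequence, indexed by n >= 1, of functions on    *)
(* E^n; values outside E^n are irrelevant.                                    *)
Definition is_element k theta (mu : forall n, n.-tuple V -> R) : Prop :=
  Theta M k theta /\
  forall n x, (0 < n)%N -> En n x -> mu n x = dens k x theta.

Definition in_model k (mu : forall n, n.-tuple V -> R) : Prop :=
  exists theta, is_element k theta mu.

Definition has_order (mu : forall n, n.-tuple V -> R) r : Prop :=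
  in_model r mu /\ forall k, in_model k mu -> nested r k.

Section Likelihood.
Variables (L : forall n, 'rV[nat]_q -> n.-tuple V -> par M -> R).
Variables (mle : forall n, 'rV[nat]_q -> n.-tuple V -> par M).

Record likelihood_spec : Prop := LikelihoodSpec {
  L_gt0 : forall n k x theta, (0 < n)%N -> En n x -> Theta M k theta ->
    0 < L k x theta ;
  mle_Theta : forall n k x, (0 < n)%N -> En n x -> Theta M k (mle k x) ;
  mle_sup : forall n k x, (0 < n)%N -> En n x ->
    (L k x (mle k x))%:E =
      ereal_sup [set (L k x theta)%:E | theta in Theta M k] ;
  L_homo : forall n k p x theta, (0 < n)%N -> En n x -> idx_le k p ->
    Theta M k theta -> L k x theta <= L p x theta ;
  L_ratio : forall k p (x : nat -> V) theta, (forall t, E (x t)) ->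
    idx_le k p -> Theta M k theta ->
    cvgn (fun n => L p (prefix_tuple x n) theta / L k (prefix_tuple x n) theta)
}.

Definition logL n k (x : n.-tuple V) (u : 'rV[R]_(gamma M k)) : R :=
  ln (L k x (point k u)).

(* Derivatives are taken at the interior points of the parameter set.         *)
Definition A2 : Prop :=
  forall k n, (0 < n)%N ->
    [/\ [/\ forall u, coord_set k u ->
              measurable_fun (En n) (fun x => @logL n k x u),
            forall u i, (coord_set k)° u ->
              measurable_fun (En n) (fun x => D1 (logL x) u 0 i),
            forall u i j, (coord_set k)° u ->
              measurable_fun (En n) (fun x => D2 (logL x) u i j)
          & forall u i j l, (coord_set k)° u ->
              measurable_fun (En n) (fun x => D3 (logL x) u i j l)],
        forall x, En n x -> forall u, (coord_set k)° u ->
          thrice_differentiable (@logL n k x) u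
      & forall x, En n x ->
        [/\ {within coord_set k, continuous (@logL n k x)},
            {within (coord_set k)°, continuous (D1 (@logL n k x))},
            {within (coord_set k)°, continuous (D2 (@logL n k x))}
          & forall i j l,
              {within (coord_set k)°,
                 continuous (fun u => D3 (@logL n k x) u i j l)}]].

Section Process.
Variables (d : measure_display) (T : measurableType d) (P : probability T R).
Variables (X : nat -> T -> V) (r : 'rV[nat]_q) (theta_r : par M).

Definition sample n (w : T) : n.-tuple V := prefix_tuple (X ^~ w) n.

Definition has_law (mu : forall n, n.-tuple V -> R) : Prop :=
  forall n (A : set (n.-tuple V)), (0 < n)%N -> measurable A ->
    P (sample n @^-1` A) =
      (\int[power_measure nu n]_(x in En n `&` A) (mu n x)%:E)%E.

Definition A1 : Prop :=
  forall k, idx_le r k ->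
    (coord_set k)° (coord k theta_r) /\
    {ae P, forall w, coord k (mle k (sample n w)) @[n --> \oo]
                       --> (coord k theta_r : 'rV[R]_(gamma M k))}.

Definition theta_dot k (s : forall n, n.-tuple V -> R) n (x : n.-tuple V) :
    'rV[R]_(gamma M k) :=
  (1 - s n x) *: coord k (mle k x) + s n x *: coord k theta_r.

Definition A3 : Prop :=
  forall k, idx_le r k ->
    exists (c : R) (Sigma : 'M[R]_(gamma M k)), sym_pos_def Sigma /\
      forall s : forall n, n.-tuple V -> R, (forall n x, 0 < s n x < 1) ->
        (forall i j l,
          {ae P, forall w,
            (limn_esup (fun n =>
               (n%:R^-1 * `|D3 (logL (sample n w))
                              (theta_dot k s (sample n w)) i j l|)%:E)
             < c%:E)%E}) /\
        {ae P, forall w,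
          - n%:R^-1 *: D2 (logL (sample n w)) (theta_dot k s (sample n w))
            @[n --> \oo] --> Sigma}.

(* The norm is the sup norm of the library; only finiteness matters.          *)
Definition A4 : Prop :=
  forall k, idx_le r k ->
    {ae P, forall w,
      (limn_esup (fun n =>
         `|(Num.sqrt (2 * n%:R * ln (ln n%:R)))^-1
             *: D1 (logL (sample n w)) (coord k theta_r)|%:E) < +oo)%E}.

(* The limit is allowed to be random and to be +oo.                           *)
Definition A5 : Prop :=
  forall k, ~~ idx_le r k ->
    {ae P, forall w, exists2 l : \bar R, (0 < l)%E &
      ((ln (L r (sample n w) (mle r (sample n w)))
        - ln (L k (sample n w) (mle k (sample n w)))) / n%:R)%:E
        @[n --> \oo] --> l}.

End Process.

Definition EDC (c : nat -> R) n (x : n.-tuple V) k : R :=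
  - ln (L k x (mle k x)) + c n * (gamma M k)%:R.

(* Ties in the argmin may be broken arbitrarily.                              *)
Definition is_EDC_estimator (c : nat -> R) (K : 'rV[nat]_q)
    (rhat : forall n, n.-tuple V -> 'rV[nat]_q) : Prop :=
  forall n x, (0 < n)%N -> En n x ->
    idx_le (rhat n x) K /\
    forall k, idx_le k K -> EDC c x (rhat n x) <= EDC c x k.

End Likelihood.
End Models.

(* Main.v *)
Require Import Defs.
From HB Require Import structures.
From mathcomp Require Import all_boot all_order all_algebra.
From mathcomp Require Import all_classical all_reals all_analysis.
From mathcomp Require Import ring lra.

Set Implicit Arguments.
Unset Strict Implicit.
Unset Printing Implicit Defensive.

Import Order.TTheory GRing.Theory Num.Theory.
Import numFieldNormedType.Exports.

Local Open Scope classical_set_scope.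
Local Open Scope ring_scope.

(** The estimator can differ from [r] only if some other [k <= K] does at least
as well as [r] in the criterion.  There are finitely many such [k], so it is
enough to show, for each of them separately, that almost surely the criterion
of [r] is eventually strictly smaller than that of [k].

If [k] is not above [r], the maximal log-likelihood of order [r] exceeds that
of order [k] by an amount at least linear in [n], which dominates the penalty
because [c n = o(n)] ([EDC_not_underfit]).

If [k] is strictly above [r], its dimension is larger, so the penalty difference
is at least [c n], which beats every multiple of [ln (ln n)]; so it is enough that the likelihood gained
by passing from [r] to [k] is [O(ln (ln n))] ([EDC_not_overfit]).  Since the
likelihood of order [r] at its maximum is at least its value at the true
parameter, and the likelihoods of orders [r] and [k] at the true parameter have
a convergent ratio ([ln_L_ratio_bounded]), what must be bounded is the increase
of the log-likelihood of order [k] from the true parameter to the maximum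
likelihood estimator ([mle_gain_le_lnln]).  A Taylor expansion to order two at
the true parameter, along the increment [h] to the estimator, writes this
increase as
  D . h + 2^-1 * (h H h^T),
where [D] is the score and [H] is the Hessian at an intermediate point.  As
[- H / n] tends to a positive definite matrix, the quadratic term is eventually
at most [- lam * n * |h|^2 / 2] for a fixed [lam > 0] ([pos_def_stable]), and
completing the square bounds the whole by a multiple of [|D|^2 / n]
([taylor2_gain_le]).  The iterated-logarithm bound on the score makes this
[O(ln (ln n))]. *)

(** * Taylor expansion to order two along a segment *)

(** Taylor's formula with Lagrange remainder, by Rolle's theorem applied to
[f t + (1 - t) f' t + C (1 - t)^2] with [C] chosen so that the values at [0]
and [1] agree. *)
Lemma taylor2_unit (R : realType) (f f' f'' : R -> R) :
  (forall t : R, 0 <= t <= 1 -> is_derive t 1 f (f' t)) ->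
  (forall t : R, 0 <= t <= 1 -> is_derive t 1 f' (f'' t)) ->
  exists2 t : R, 0 < t < 1 & f 1 - f 0 = f' 0 + 2^-1 * f'' t.
Proof.
move=> df df'.
pose C := f 1 - f 0 - f' 0.
pose psi : R -> R := f + (cst 1 - id) * f' + C *: ((cst 1 - id) * (cst 1 - id)).
have dpsi (t : R) : 0 <= t <= 1 -> is_derive t 1 psi ((1 - t) * (f'' t - 2 * C)).
  move=> t01; have ? := df _ t01; have ? := df' _ t01.
  apply: is_derive_eq; rewrite /= /GRing.scale /= /cst /=.
  rewrite !fctE; ring.
have [t|||t t01 dpsi0] := @Rolle _ psi 0 1 ltr01.
- by rewrite in_itv/= => /andP[/ltW t0 /ltW t1]; have [] := dpsi t; rewrite ?t0.
- apply: derivable_within_continuous => t; rewrite in_itv/= => t01.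
  by have [] := dpsi t.
- rewrite /psi /cst /= !fctE /= /GRing.scale /= /C; ring.
move: t01; rewrite in_itv/= => t01; exists t => //.
have t01' : 0 <= t <= 1 by lra.
have [_ e1] := dpsi _ t01'; have [_ e0] := dpsi0.
move: e1; rewrite e0 => /esym/eqP; rewrite mulf_eq0 => /orP[|]/eqP; first by lra.
by rewrite /C; lra.
Qed.

Lemma is_derive_line (R : realType) (V : normedModType R) (g : V -> R)
    (u h : V) (t : R) :
  derivable g (u + t *: h) h ->
  is_derive t 1 (fun s => g (u + s *: h)) ('D_h g (u + t *: h)).
Proof.
rewrite /derivable /derive => dg.
set F := (fun k => k^-1 *: ((g \o shift (u + t *: h)) (k *: h) - g (u + t *: h))) in dg *.
have FE : (fun k : R => k^-1 *: (((fun s => g (u + s *: h)) \o shift t) (k *: 1)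
  - g (u + t *: h))) = F.
  apply/funext => k; rewrite /F /= addrCA; congr (_ *: (g _ - _)).
  by rewrite -mulr_algl mulr1 scalerDl [k%:A]mulr1.
by split; rewrite /derivable /derive FE.
Qed.

Section Gradient.
Variables (R : realType) (d : nat).
Implicit Types (g : 'rV[R]_d -> R) (u v h : 'rV[R]_d).

Lemma derive_gradient g u h : differentiable g u ->
  'D_h g u = \sum_i h 0 i * D1 g u 0 i.
Proof.
move=> dg; rewrite deriveE// {1}[h]row_sum_delta linear_sum.
by apply: eq_bigr => i _; rewrite linearZ /= mxE deriveE.
Qed.

(** The intermediate point is written as a combination weighted by [1 - s] at the
far end [v], so that with [u] the true parameter and [v] the estimator it is
literally the point [theta_dot]. *)
Lemma taylor2_segment g u v :
  (forall t : R, 0 <= t <= 1 -> thrice_differentiable g (u + t *: (v - u))) ->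
  exists2 s : R, 0 < s < 1 &
    g v - g u = (D1 g u *m (v - u)^T) 0 0 +
      2^-1 * ((v - u) *m D2 g ((1 - s) *: v + s *: u) *m (v - u)^T) 0 0.
Proof.
move=> dg; set h := v - u in dg *.
pose line t : 'rV[R]_d := u + t *: h.
pose phi' (t : R) := \sum_i h 0 i * D1 g (line t) 0 i.
pose phi'' (t : R) := \sum_i h 0 i * \sum_j h 0 j * D2 g (line t) i j.
have [t t01||t t01] := @taylor2_unit R (fun t => g (line t)) phi' phi''.
- have [dgt _ _] := dg _ t01.
  rewrite /phi' -derive_gradient//.
  by apply: is_derive_line; exact: diff_derivable.
- move=> t t01; have [_ dg1 _] := dg _ t01.
  have -> : phi' = \sum_i (fun t => h 0 i *: D1 g (line t) 0 i).
    by apply/funext => s; rewrite /phi' fct_sumE.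
  have ? i : is_derive t 1 (fun t : R => h 0 i *: D1 g (line t) 0 i)
      (h 0 i * \sum_j h 0 j * D2 g (line t) i j).
    have -> : \sum_j h 0 j * D2 g (line t) i j
        = 'D_h (fun w => D1 g w 0 i) (line t).
      by rewrite derive_gradient//; apply: eq_bigr => j _; rewrite !mxE.
    have ? : is_derive t 1 (fun s => D1 g (line s) 0 i)
        ('D_h (fun w => D1 g w 0 i) (line t)).
      apply: (@is_derive_line _ _ (fun w => D1 g w 0 i)).
      exact: diff_derivable.
    exact: is_deriveZ.
  exact: is_derive_sum.
move=> gE; exists (1 - t); first lra.
have l0 : line 0 = u by rewrite /line scale0r addr0.
have l1 : line 1 = v by rewrite /line scale1r addrC subrK.
have lt : (1 - (1 - t)) *: v + (1 - t) *: u = line t.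
  by rewrite /line /h subKr scalerBl scale1r scalerBr addrCA.
rewrite lt -{1}l0 -{1}l1 gE /phi' l0; congr (_ + _ * _).
  by rewrite mxE; apply: eq_bigr => i _; rewrite [h^T _ _]mxE mulrC.
rewrite -mulmxA mxE; apply: eq_bigr => i _; congr (_ * _).
by rewrite mxE; apply: eq_bigr => j _; rewrite [h^T _ _]mxE mulrC.
Qed.

End Gradient.

(** * Quadratic forms in the sup norm *)

Section QuadraticForms.
Variables (R : realType) (d : nat).
Implicit Types (h v : 'rV[R]_d) (A S : 'M[R]_d).

Lemma mx_entry_le_norm m n (A : 'M[R]_(m, n)) i j : `|A i j| <= `|A|.
Proof.
rewrite [leRHS]/Num.norm /= mx_normrE.
by apply/bigmax_geP; right; exists (i, j).
Qed.

Lemma sum_le_card (F : 'I_d -> R) c : (forall i, F i <= c) ->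
  \sum_i F i <= d%:R * c.
Proof.
move=> Fc; apply: (@le_trans _ _ (\sum_(i < d) c)); first exact: ler_sum.
by rewrite sumr_const card_ord mulr_natl.
Qed.

Lemma dot_le_norm v h : `|(v *m h^T) 0 0| <= d%:R * (`|v| * `|h|).
Proof.
rewrite mxE (le_trans (ler_norm_sum _ _ _))//.
apply: sum_le_card => i.
by rewrite normrM mxE ler_pM// mx_entry_le_norm.
Qed.

Lemma quad_le_norm A h :
  `|(h *m A *m h^T) 0 0| <= d%:R ^+ 2 * `|A| * `|h| ^+ 2.
Proof.
apply: le_trans (dot_le_norm _ _) _.
have hA : `|h *m A| <= d%:R * (`|h| * `|A|).
  rewrite {1}/Num.norm /= mx_normrE; apply/bigmax_leP; split => [|[i j] _ /=].
    by rewrite mulr_ge0// mulr_ge0.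
  rewrite mxE (le_trans (ler_norm_sum _ _ _))//.
  apply: sum_le_card => k.
  by rewrite normrM ler_pM// mx_entry_le_norm.
have -> : d%:R ^+ 2 * `|A| * `|h| ^+ 2 = d%:R * (d%:R * (`|h| * `|A|) * `|h|).
  by ring.
by rewrite ler_wpM2l// ler_wpM2r.
Qed.

Lemma continuous_sum (T : topologicalType) (F : 'I_d -> T -> R) :
  (forall i, continuous (F i)) -> continuous (fun x => \sum_i F i x).
Proof.
move=> cF; have add_cont : continuous (fun x : R * R => x.1 + x.2).
  exact: add_continuous.
exact: (@continuous_big R 'I_d +%R 0 xpredT add_cont T _ F (fun i _ => cF i)).
Qed.

Lemma quad_continuous A : continuous (fun h => (h *m A *m h^T) 0 0).
Proof.
have -> : (fun h => (h *m A *m h^T) 0 0) =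
    (fun h => \sum_j (\sum_i h 0 i * A i j) * h 0 j).
  by apply/funext => h; rewrite mxE; apply: eq_bigr => j _; rewrite !mxE.
apply: (@continuous_sum _ (fun j h => (\sum_i h 0 i * A i j) * h 0 j)) => j v.
have cF i : continuous (fun h : 'rV[R]_d => h 0 i * A i j).
  move=> h; apply: (@continuousM R _ (fun h : 'rV[R]_d => h 0 i) (cst (A i j))).
    exact: coord_continuous.
  exact: cst_continuous.
apply: (@continuousM R _ (fun h => \sum_i h 0 i * A i j)
                         (fun h : 'rV[R]_d => h 0 j)).
  exact: (continuous_sum cF).
exact: coord_continuous.
Qed.

(** Compactness of the unit sphere: the form attains there a positive minimum
[lam], and homogeneity extends the bound to every vector. *)
Lemma pos_def_coercive A : sym_pos_def A ->
  exists2 lam : R, 0 < lam & forall h, lam * `|h| ^+ 2 <= (h *m A *m h^T) 0 0.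
Proof.
move=> [_ A_gt0].
(* The sphere is empty in dimension 0, where there is no minimum to take. *)
have [[v0 v0_neq0]|no_neq0] := pselect (exists v : 'rV[R]_d, v != 0); last first.
  exists 1 => // h; suff -> : h = 0 by rewrite normr0 !mul0mx mxE expr0n mulr0.
  by apply: contrapT => /eqP h0; apply: no_neq0; exists h.
pose sphere := [set v : 'rV[R]_d | `|v| = 1].
have normalized v : v != 0 -> sphere (`|v|^-1 *: v).
  by move=> vn0; rewrite /sphere /= normrZ normfV normr_id mulVf// normr_eq0.
have sphere_compact : compact sphere.
  apply: bounded_closed_compact.
    by exists 1; split => // x x1 v /= ->; exact: ltW.
  have -> : sphere = (fun v : 'rV[R]_d => `|v|) @^-1` [set 1] by [].
  apply: closed_comp; last exact: closed_eq.
  by move=> v _; exact: norm_continuous.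
have [|v] := EVT_min_rV _ sphere_compact (continuous_subspaceT (@quad_continuous A)).
  by exists (`|v0|^-1 *: v0); exact: normalized.
rewrite inE => sv vmin; exists ((v *m A *m v^T) 0 0).
  by apply: A_gt0; rewrite -normr_eq0 sv oner_eq0.
move=> h; have [->|h0] := eqVneq h 0.
  by rewrite normr0 !mul0mx [leRHS]mxE expr0n mulr0.
have := vmin (`|h|^-1 *: h); rewrite inE => /(_ (normalized _ h0)).
rewrite [(_ *: h)^T]linearZ -!scalemxAl -scalemxAr [leRHS]mxE.
rewrite [(_ *: (_ *m _)) 0 0]mxE => le_min.
have h_gt0 : 0 < `|h| by rewrite normr_gt0.
rewrite mulrC -ler_pdivlMl ?exprn_gt0//; apply: le_trans le_min _.
by rewrite -exprVn expr2 mulrA.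
Qed.

(** Coercivity survives small perturbations of the matrix, with a constant that
does not depend on the perturbed matrix; this is what convergence of the
normalized Hessians is used for. *)
Lemma pos_def_stable A : sym_pos_def A ->
  exists e lam : R, [/\ 0 < e, 0 < lam & forall S h, `|A - S| < e ->
    lam * `|h| ^+ 2 <= (h *m S *m h^T) 0 0].
Proof.
move=> /pos_def_coercive[lam lam0 coer].
(* Adding 1 keeps the divisor [2 * D] positive in dimension 0. *)
pose D : R := d%:R ^+ 2 + 1.
have D_gt0 : 0 < D by rewrite ltr_pwDr// sqr_ge0.
exists (lam / (2 * D)), (lam / 2); split; [by rewrite divr_gt0// mulr_gt0|lra|].
move=> S h; rewrite ltr_pdivlMr ?mulr_gt0// => AS.
have -> : (h *m S *m h^T) 0 0 =
    (h *m A *m h^T) 0 0 - (h *m (A - S) *m h^T) 0 0.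
  by rewrite mulmxBr mulmxBl !mxE opprB addrC subrK.
have := quad_le_norm (A - S) h; rewrite ler_norml => /andP[_ qle].
have := coer h; have : d%:R ^+ 2 * `|A - S| * `|h| ^+ 2 <= lam / 2 * `|h| ^+ 2.
  apply: ler_wpM2r; first by rewrite exprn_ge0.
  have := normr_ge0 (A - S); rewrite /D in AS; nra.
lra.
Qed.

End QuadraticForms.

(** Completing the square: the difference of the two sides is a square divided
by [2 * lam * n]. *)
Lemma concave_quadratic_le (R : realFieldType) (a x n lam : R) :
  0 < n -> 0 < lam -> a * x - 2^-1 * (n * (lam * x ^+ 2)) <= a ^+ 2 / (2 * lam * n).
Proof.
move=> n0 lam0; rewrite ler_pdivlMr ?mulr_gt0// -subr_ge0.
have -> : a ^+ 2 - (a * x - 2^-1 * (n * (lam * x ^+ 2))) * (2 * lam * n) =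
  (a - n * lam * x) ^+ 2 by field.
exact: sqr_ge0.
Qed.

(** A linear term minus a coercive quadratic one is bounded uniformly in the
increment [h], so the gain is controlled by the score alone. *)
Lemma taylor2_gain_le (R : realType) (d : nat) (n lam gain : R)
    (D h : 'rV[R]_d) (H : 'M[R]_d) :
  0 < n -> 0 < lam ->
  gain = (D *m h^T) 0 0 + 2^-1 * (h *m H *m h^T) 0 0 ->
  lam * `|h| ^+ 2 <= (h *m (- n^-1 *: H) *m h^T) 0 0 ->
  gain <= d%:R ^+ 2 * `|D| ^+ 2 / (2 * lam * n).
Proof.
move=> n0 lam0 -> coer.
have := concave_quadratic_le (d%:R * `|D|) `|h| n0 lam0.
rewrite exprMn; apply: le_trans; apply: lerD.
  by rewrite -mulrA; apply: le_trans (dot_le_norm _ _); exact: ler_norm.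
move: coer; rewrite -scalemxAr -scalemxAl mxE => coer.
rewrite -mulrN ler_pM2l ?invr_gt0// lerNr.
by rewrite -ler_pdivlMl//; move: coer; rewrite mulNr mulrN.
Qed.

(** * Eventual bounds for sequences *)

Section RealSequences.
Variable R : realType.
Implicit Types (u c : nat -> R).

Lemma limn_esup_lt_le u (b : \bar R) :
  (limn_esup (fun n => (u n)%:E) < b)%E ->
  exists2 a : R, (a%:E <= b)%E & \forall n \near \oo, u n <= a.
Proof.
move=> /ereal_inf_lt[_ [V ooV <-]] supV.
have u_le n : V n -> ((u n)%:E <= ereal_sup [set (u n)%:E | n in V])%E.
  by move=> Vn; apply: ereal_sup_ubound; exists n.
case supE : (ereal_sup _) supV u_le => [a| |] supV u_le.
- by exists a; [exact: ltW|exact: filterS ooV].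
- by rewrite ltNge leey in supV.
- have [n Vn] : V !=set0 by exact: filter_ex ooV.
  by have := u_le n Vn; rewrite leeNy_eq.
Qed.

Lemma limn_einf_eqy_ge u (a : R) :
  limn_einf (fun n => (u n)%:E) = +oo%E -> \forall n \near \oo, a <= u n.
Proof.
move=> /(congr1 oppe); rewrite oppeK => esupN.
have [|b ba] := @limn_esup_lt_le (fun n => - u n) (- a)%:E.
  by rewrite (_ : limn_esup _ = -oo%E)// ltNyr.
rewrite lee_fin in ba; apply: filterS => n un.
by rewrite -lerN2 (le_trans un).
Qed.

Lemma lnln_ge (a : R) : \forall n \near \oo, a <= ln (ln n%:R).
Proof.
near=> n.
have n_ge : expR (expR a) <= n%:R by near: n; exact: nbhs_infty_ger.
have n_gt0 : 0 < n%:R :> R by apply: lt_le_trans n_ge; exact: expR_gt0.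
have ln_ge : expR a <= ln n%:R by rewrite -ler_expR lnK.
have ln_gt0 : 0 < ln n%:R :> R by apply: lt_le_trans ln_ge; exact: expR_gt0.
by rewrite -ler_expR lnK.
Unshelve. all: by end_near. Qed.

(** The factor [a + 1] absorbs the strictness once [ln (ln n)] is positive. *)
Lemma lnln_lt_penalty c (a : R) :
  limn_einf (fun n => (c n / ln (ln n%:R))%:E) = +oo%E ->
  \forall n \near \oo, a * ln (ln n%:R) < c n.
Proof.
move=> c_ll; near=> n.
have ll_ge1 : 1 <= ln (ln n%:R) :> R by near: n; exact: lnln_ge.
have : a + 1 <= c n / ln (ln n%:R) by near: n; exact: limn_einf_eqy_ge.
by rewrite ler_pdivlMr; nra.
Unshelve. all: by end_near. Qed.

End RealSequences.

(** * Finiteness of the set of candidate orders *)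

Section Indices.
Variable q : nat.
Implicit Types k K : 'rV[nat]_q.

(** A filter is stable under finite intersections, and the orders below [K] are
among the vectors with entries in an ordinal type bounding all the entries of
[K].  It is used for almost sure events and for eventual ones alike. *)
Lemma filter_forall_idx_le T (F : set_system T) K (Q : 'rV[nat]_q -> T -> Prop) :
  Filter F -> (forall k, idx_le k K -> \forall x \near F, Q k x) ->
  \forall x \near F, forall k, idx_le k K -> Q k x.
Proof.
move=> FF FQ; pose N := \max_i K ord0 i.
pose of_ord (k : 'rV['I_N.+1]_q) : 'rV[nat]_q := map_mx (@nat_of_ord _) k.
have : \forall x \near F, forall i, idx_le (of_ord i) K -> Q (of_ord i) x.
  apply: filter_forall => i.
  have [iK|niK] := boolP (idx_le (of_ord i) K).
    by apply: filterS (FQ _ iK) => x Qx _.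
  exact: nearW.
apply: filterS => x Qx k kK.
suff kE : of_ord (map_mx inord k) = k by rewrite -kE; apply: Qx; rewrite kE.
apply/rowP => i; rewrite !mxE inordK// ltnS.
by rewrite (leq_trans (forallP kK i))// leq_bigmax.
Qed.

End Indices.

(** * Comparison of the criterion at two orders *)

Section Consistency.
Variables (R : realType) (m q : nat) (E : set (m.-tuple R)).
Variables (nu : {measure set (m.-tuple R) -> \bar R}).
Variable (M : model_class q E nu).
Variables (L : forall n, 'rV[nat]_q -> n.-tuple (m.-tuple R) -> par M -> R).
Variables (mle : forall n, 'rV[nat]_q -> n.-tuple (m.-tuple R) -> par M).
Hypothesis L_mle : likelihood_spec L mle.
Variables (d : measure_display) (T : measurableType d) (P : probability T R).
Variables (X : nat -> T -> m.-tuple R) (r : 'rV[nat]_q) (theta_r : par M).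
Hypothesis XE : forall t w, E (X t w).
Local Notation V := (m.-tuple R).
Local Notation En := (power_set_tuple E).
Local Notation coord := Defs.coord.

Let sample_En n w : En n (sample X n w).
Proof. by move=> i; rewrite tnth_mktuple. Qed.

(** The admissible weight [s] has to be found for every sample, including those
whose estimator is far from the true parameter, because the hypothesis on the
Hessians takes a function [s] defined everywhere; away from the ball any [s]
does. *)
Lemma exists_taylor_point k n (x : n.-tuple V) (e : R) :
  A2 L -> ball (coord k theta_r) e `<=` (@coord_set _ _ _ _ _ M k)° ->
  exists s : R, 0 < s < 1 /\
    ((0 < n)%N -> En n x -> ball (coord k theta_r) e (coord k (mle k x)) ->
     let u := coord k theta_r in let v := coord k (mle k x) in
     logL L x v - logL L x u = (D1 (logL L x) u *m (v - u)^T) 0 0 +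
      2^-1 * ((v - u) *m D2 (logL L x) ((1 - s) *: v + s *: u)
        *m (v - u)^T) 0 0).
Proof.
move=> hA2 e_int.
have [[[n0 xE] vB]|nP] :=
  pselect (((0 < n)%N /\ En n x) /\ ball (coord k theta_r) e (coord k (mle k x)));
  last by exists 2^-1; split; [lra|move=> *; exfalso; exact: nP].
have [_ dL _] := hA2 k n n0.
set u := coord k theta_r in e_int vB *; set v := coord k (mle k x) in vB *.
have [t t01|s s01 sE] := @taylor2_segment R _ (logL L x) u v.
  apply: dL => //; apply: e_int; move: vB.
  rewrite -!ball_normE /= => uv.
  rewrite opprD addNKr normrN normrZ distrC.
  by rewrite ger0_norm; have := normr_ge0 (u - v); nra.
by exists s; split.
Qed.

Lemma mle_ge k n (x : n.-tuple V) theta : (0 < n)%N -> En n x ->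
  Theta M k theta -> L k x theta <= L k x (mle k x).
Proof.
move=> n0 xE th; rewrite -lee_fin (mle_sup L_mle)//.
by apply: ereal_sup_ubound; exists theta.
Qed.

(** The score is [O(sqrt (n ln (ln n)))] and the curvature is of order [n], so
the quotient [|D|^2 / n] bounding the gain is [O(ln (ln n))].  The weights [s]
are chosen before the sample path [w], so that a single almost sure event gives
the convergence of all the Hessians involved. *)
Lemma mle_gain_le_lnln k : idx_le r k -> Theta M k theta_r ->
  A1 mle P X r theta_r -> A2 L -> A3 L mle P X r theta_r -> A4 L P X r theta_r ->
  {ae P, forall w, exists C : R, \forall n \near \oo,
     ln (L k (sample X n w) (mle k (sample X n w)))
     - ln (L k (sample X n w) theta_r) <= C * ln (ln n%:R)}.
Proof.
move=> rk th_k /(_ k rk)[th_int mle_cvg] hA2 /(_ k rk)[b [Sigma [Spos hA3]]].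
move=> /(_ k rk) hA4.
have : nbhs (coord k theta_r) (@coord_set _ _ _ _ _ M k)°.
  by apply: open_nbhs_nbhs; split => //; exact: open_interior.
move=> /nbhs_ballP[e /= e0 e_int].
pose s n (x : n.-tuple V) : R :=
  sval (cid (@exists_taylor_point k n x e hA2 e_int)).
have [|_ hess_cvg] := hA3 s.
  by move=> n x; rewrite /s; case: cid => /= ? [].
have [e' [lam [e'0 lam0 coer]]] := pos_def_stable Spos.
apply: filterS3 mle_cvg hess_cvg hA4.
move=> w mle_cvg hess_cvg /limn_esup_lt_le[C _ score_le].
exists ((gamma M k)%:R ^+ 2 * C ^+ 2 / lam).
pose x n := sample X n w; near=> n.
have n0 : (0 < n)%N by near: n; exact: nbhs_infty_gt.
have nR : 0 < n%:R :> R by rewrite ltr0n.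
have ll_ge1 : 1 <= ln (ln n%:R) :> R by near: n; exact: lnln_ge.
have mle_ball : ball (coord k theta_r) e (coord k (mle k (x n))).
  near: n; have /cvg_ballP := mle_cvg; exact.
have hess : `|Sigma - (- n%:R^-1 *:
    D2 (logL L (x n)) (theta_dot mle theta_r k s (x n)))| < e'.
  near: n; have /cvgrPdist_lt := hess_cvg; exact.
have score : `|(Num.sqrt (2 * n%:R * ln (ln n%:R)))^-1
    *: D1 (logL L (x n)) (coord k theta_r)| <= C.
  by near: n.
have z_gt0 : 0 < 2 * n%:R * ln (ln n%:R) :> R.
  by rewrite mulr_gt0 ?mulr_gt0// (lt_le_trans _ ll_ge1).
have {}score : `|D1 (logL L (x n)) (coord k theta_r)| ^+ 2
    <= C ^+ 2 * (2 * n%:R * ln (ln n%:R)).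
  move: score; rewrite normrZ normfV ger0_norm ?sqrtr_ge0//.
  rewrite ler_pdivrMl ?sqrtr_gt0// => score.
  rewrite -[X in _ * X](sqr_sqrtr (ltW z_gt0)) -exprMn.
  by rewrite ler_sqr ?nnegrE// [C * _]mulrC// (le_trans _ score).
have [_ /(_ n0 (sample_En w) mle_ball) taylor] :=
  svalP (cid (exists_taylor_point (x n) hA2 e_int)).
have := taylor2_gain_le nR lam0 taylor (coer _ _ hess).
have th_mle : Theta M k (mle k (x n)).
  by apply: (mle_Theta L_mle) => //; exact: sample_En.
rewrite /logL !coordK//.
move=> /le_trans; apply.
rewrite ler_pdivrMr ?mulr_gt0//.
have -> : (gamma M k)%:R ^+ 2 * C ^+ 2 / lam * ln (ln n%:R) * (2 * lam * n%:R)
    = (gamma M k)%:R ^+ 2 * (C ^+ 2 * (2 * n%:R * ln (ln n%:R))).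
  by field; rewrite gt_eqF.
by rewrite ler_wpM2l// exprn_ge0.
Unshelve. all: by end_near. Qed.

(** Only an upper bound on the ratio matters, and [ln x < x] turns it into one on
its logarithm. *)
Lemma ln_L_ratio_bounded k w : idx_le r k -> Theta M r theta_r ->
  Theta M k theta_r -> exists B : R, \forall n \near \oo,
    ln (L k (sample X n w) theta_r) - ln (L r (sample X n w) theta_r) <= B.
Proof.
move=> rk th_r th_k.
have /cvg_ex[/= l ratio_cvg] :=
  L_ratio L_mle (fun t => XE t w) rk th_r.
exists (l + 1); near=> n.
have n0 : (0 < n)%N by near: n; exact: nbhs_infty_gt.
have Lk := L_gt0 L_mle n0 (@sample_En n w) th_k.
have Lr := L_gt0 L_mle n0 (@sample_En n w) th_r.
rewrite -ln_div ?posrE//.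
apply: (@le_trans _ _ (L k (sample X n w) theta_r / L r (sample X n w) theta_r)).
  by apply/ltW/ln_sublinear; rewrite divr_gt0.
apply: ltW; near: n; apply: (cvgr_lt _ ratio_cvg); lra.
Unshelve. all: by end_near. Qed.

(** The penalty paid for the extra dimensions is at least [c n], and exceeds the
[O(ln (ln n))] gain in log-likelihood. *)
Lemma EDC_not_overfit (c : nat -> R) k :
  idx_le r k -> Theta M r theta_r -> Theta M k theta_r ->
  (gamma M r < gamma M k)%N -> (forall n, 0 < c n) ->
  limn_einf (fun n => (c n / ln (ln n%:R))%:E) = +oo%E ->
  A1 mle P X r theta_r -> A2 L -> A3 L mle P X r theta_r -> A4 L P X r theta_r ->
  {ae P, forall w, \forall n \near \oo,
     EDC L mle c (sample X n w) r < EDC L mle c (sample X n w) k}.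
Proof.
move=> rk th_r th_k gam c0 c_ll hA1 hA2 hA3 hA4.
apply: filterS (mle_gain_le_lnln rk th_k hA1 hA2 hA3 hA4) => w [C gain].
have [B ratio] := ln_L_ratio_bounded w rk th_r th_k.
pose x n := sample X n w; near=> n.
have n0 : (0 < n)%N by near: n; exact: nbhs_infty_gt.
have B_ll : B <= ln (ln n%:R) by near: n; exact: lnln_ge.
(* [C] pays for the Taylor gain, 1 for the bounded log-ratio. *)
have pen : (C + 1) * ln (ln n%:R) < c n by near: n; exact: lnln_lt_penalty.
have gain_n : ln (L k (x n) (mle k (x n))) - ln (L k (x n) theta_r)
    <= C * ln (ln n%:R).
  by near: n.
have ratio_n : ln (L k (x n) theta_r) - ln (L r (x n) theta_r) <= B by near: n.
have xE : En n (x n) by exact: sample_En.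
have mle_r : ln (L r (x n) theta_r) <= ln (L r (x n) (mle r (x n))).
  have Lr := L_gt0 L_mle n0 xE th_r.
  have le := mle_ge n0 xE th_r.
  by rewrite ler_ln ?posrE// (lt_le_trans Lr).
have gamR : (gamma M r)%:R + 1 <= (gamma M k)%:R :> R by rewrite natr1 ler_nat.
have cgam : c n * (gamma M r)%:R + c n <= c n * (gamma M k)%:R.
  by rewrite -[X in _ + X <= _]mulr1 -mulrDr ler_wpM2l// ltW.
rewrite /EDC; lra.
Unshelve. all: by end_near. Qed.

(** A model that misses the truth loses a positive amount of log-likelihood per
observation, while the penalty per observation vanishes. *)
Lemma EDC_not_underfit (c : nat -> R) k : ~~ idx_le r k -> (forall n, 0 < c n) ->
  c n / n%:R @[n --> \oo] --> 0 -> A5 L mle P X r ->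
  {ae P, forall w, \forall n \near \oo,
     EDC L mle c (sample X n w) r < EDC L mle c (sample X n w) k}.
Proof.
move=> rk c0 c_n /(_ k rk); apply: filterS => w [l l0 gap_cvg].
have [a a0 al] : exists2 a : R, 0 < a & (a%:E < l)%E.
  case: l l0 {gap_cvg} => [l| |]//; rewrite ?lte_fin => l0.
    by exists (l / 2); rewrite ?lte_fin; lra.
  by exists 1; rewrite ?ltry.
pose x n := sample X n w; near=> n.
have n0 : (0 < n)%N by near: n; exact: nbhs_infty_gt.
have nR : 0 < n%:R :> R by rewrite ltr0n.
have gap : (a%:E < ((ln (L r (x n) (mle r (x n)))
    - ln (L k (x n) (mle k (x n)))) / n%:R)%:E)%E.
  by near: n; exact: (gap_cvg _ (open_ereal_gt' al)).
(* Adding 1 to the dimension avoids a division by zero when it vanishes. *)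
have pen : c n / n%:R < a / ((gamma M r)%:R + 1).
  by near: n; apply: (cvgr_lt _ c_n); rewrite divr_gt0// ltr_pwDr.
move: gap; rewrite lte_fin ltr_pdivlMr// => gap.
have gam_gt0 : 0 < (gamma M r)%:R + 1 :> R by rewrite ltr_pwDr.
have {}pen : c n * ((gamma M r)%:R + 1) < a * n%:R.
  by move: pen; rewrite ltr_pdivrMr// mulrAC ltr_pdivlMr.
have cn := c0 n.
have : 0 <= c n * (gamma M k)%:R by rewrite mulr_ge0// ltW.
rewrite /EDC; lra.
Unshelve. all: by end_near. Qed.

End Consistency.

(** * Strong consistency *)

Theorem theorem1 (R : realType) (m q : nat)
    (E : set (m.-tuple R)) (mE : measurable E)
    (nu : {measure set (m.-tuple R) -> \bar R})
    (M : model_class q E nu) (M_nested : partially_nested M)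
    (d : measure_display) (T : measurableType d) (P : probability T R)
    (X : nat -> T -> m.-tuple R)
    (mX : forall t, measurable_fun setT (X t))
    (XE : forall t w, E (X t w))
    (r K : 'rV[nat]_q) (rK : idx_le r K)
    (m_r : forall n, n.-tuple (m.-tuple R) -> R)
    (m_r_law : has_law E nu P X m_r)
    (m_r_order : has_order M m_r r)
    (theta_r : par M) (theta_r_true : is_element r theta_r m_r)
    (L : forall n, 'rV[nat]_q -> n.-tuple (m.-tuple R) -> par M -> R)
    (mle : forall n, 'rV[nat]_q -> n.-tuple (m.-tuple R) -> par M)
    (L_mle : likelihood_spec L mle)
    (gamma_lt : forall k, idx_le r k -> idx_le k K -> k != r ->
       (gamma M r < gamma M k)%N)
    (c : nat -> R) (c_gt0 : forall n, 0 < c n)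
    (rhat : forall n, n.-tuple (m.-tuple R) -> 'rV[nat]_q)
    (rhat_EDC : is_EDC_estimator L mle c K rhat) :
  A1 mle P X r theta_r ->
  A2 L ->
  A3 L mle P X r theta_r ->
  A4 L P X r theta_r ->
  A5 L mle P X r ->
  limn_einf (fun n => (c n / ln (ln n%:R))%:E) = +oo%E ->
  c n / n%:R @[n --> \oo] --> 0 ->
  {ae P, forall w, rhat n (sample X n w) @[n --> \oo] --> r}.
Proof.
move=> hA1 hA2 hA3 hA4 hA5 c_ll c_n.
have th_r := theta_r_true.1.
have th_k k : idx_le r k -> Theta M k theta_r.
  by move=> rk; have [+ _] := (M_nested r k).2 rk; apply.
have EDC_gap : {ae P, forall w, forall k, idx_le k K -> k != r ->
    \forall n \near \oo,
      EDC L mle c (sample X n w) r < EDC L mle c (sample X n w) k}.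
  apply: filter_forall_idx_le => k kK.
  have [->|kr] := eqVneq k r; first by apply: nearW.
  have [rk|nrk] := boolP (idx_le r k).
    apply: filterS (EDC_not_overfit L_mle XE rk th_r (th_k k rk)
      (gamma_lt k rk kK kr) c_gt0 c_ll hA1 hA2 hA3 hA4) => w + _; exact.
  apply: filterS (EDC_not_underfit nrk c_gt0 c_n hA5) => w + _; exact.
apply: filterS EDC_gap => w EDC_gap.
have : \forall n \near \oo, forall k, idx_le k K -> k != r ->
    EDC L mle c (sample X n w) r < EDC L mle c (sample X n w) k.
  apply: filter_forall_idx_le => k kK.
  have [->|kr] := eqVneq k r; first by apply: nearW.
  by apply: filterS (EDC_gap k kK kr) => n + _; exact.
move=> r_best; apply: cvg_near_cst; near=> n.
have n0 : (0 < n)%N by near: n; exact: nbhs_infty_gt.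
have best : forall k, idx_le k K -> k != r ->
    EDC L mle c (sample X n w) r < EDC L mle c (sample X n w) k by near: n.
have sE : power_set_tuple E n (sample X n w) by move=> i; rewrite tnth_mktuple.
have [rhat_K rhat_min] := rhat_EDC n _ n0 sE.
apply/eqP/negP => /negP rhat_r.
by have := best _ rhat_K rhat_r; rewrite ltNge rhat_min.
Unshelve. all: by end_near. Qed.
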